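(* There is a countable $\aleph_0$-saturated generalized rational metric space.
   Context: A generalized metric space is a set $X$ with a distance $d:X\times X\to[0,\infty]$ satisfying all the axioms of a metric, except that the value $\infty$ is allowed. It is called rational if all of its distances are either rational numbers or $\infty$. An isometry is a (not necessarily surjective) distance-preserving map. An $\aleph_0$-saturated generalized rational metric space is a generalized rational metric space $K$ that is injective to morphisms between finite spaces in the category of generalized rational metric spaces and isometries; that is, for every isometry $f:A\to B$ between finite generalized rational metric spaces and every isometry $g:A\to K$, there is an isometry $h:B\to K$ with $hf=g$. *)

(* Defs.v *)
From HB Require Import structures.
From mathcomp Require Import all_boot all_order all_algebra.
From mathcomp Require Import boolp classical_sets functions cardinality.
From mathcomp Require Import reals ereal.

Set Implicit Arguments.
Unset Strict Implicit.
Unset Printing Implicit Defensive.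

Import Order.TTheory GRing.Theory Num.Theory.

Local Open Scope classical_set_scope.
Local Open Scope ring_scope.
Local Open Scope ereal_scope.

(* The carrier is a bare Type so that the empty space is included. *)
Record gmetric (R : realType) := GMetric {
  gpoint :> Type;
  gdist : gpoint -> gpoint -> \bar R;
  gdist_ge0 : forall x y, 0 <= gdist x y;
  gdist_eq0 : forall x y, gdist x y = 0 <-> x = y;
  gdist_sym : forall x y, gdist x y = gdist y x;
  gdist_triangle : forall x y z, gdist x z <= gdist x y + gdist y z
}.

Definition rational_gmetric (R : realType) (X : gmetric R) : Prop :=
  forall x y : X, gdist x y = +oo \/ exists q : rat, gdist x y = (ratr q)%:E.

Definition isometry (R : realType) (X Y : gmetric R) (f : X -> Y) : Prop :=
  forall x y : X, gdist (f x) (f y) = gdist x y.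

Definition finite_gmetric (R : realType) (X : gmetric R) : Prop :=
  finite_set [set: X].

Definition aleph0_saturated (R : realType) (K : gmetric R) : Prop :=
  rational_gmetric K /\
  forall (A B : gmetric R) (f : A -> B) (g : A -> K),
    rational_gmetric A -> finite_gmetric A ->
    rational_gmetric B -> finite_gmetric B ->
    isometry f -> isometry g ->
    exists h : B -> K, isometry h /\ h \o f = g.

(* Main.v *)
Require Import Defs.
From HB Require Import structures.
From mathcomp Require Import all_boot all_order all_algebra.
From mathcomp Require Import boolp classical_sets functions cardinality.
From mathcomp Require Import reals ereal.

(** A rational distance is built on the set of natural numbers, one point at a
    time.  Suppose that a distance [d] is given, that [s] is a finite list of
    pairs (point, prescribed distance) with positive prescribed distances, and
    that [d x y <= q + r] for all [(x, q)] and [(y, r)] in [s].  Then a point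
    [p] outside [s] can be repositioned by gluing along [s]: its distance to
    any other [m] becomes the minimum of [q + d x m] over [(x, q)] in [s], with
    [+oo] for the empty minimum.  This is again a distance
    ([rational_distance_glue]); positivity of the prescribed values keeps
    distinct points apart, so that no quotient is ever needed.

    The lists with prescribed values in rat or infinite are countably many, so
    they can be enumerated in such a way that each one occurs at arbitrarily
    large indices ([request_unbounded]).  At stage [n] the point [n] is glued
    along the [n]-th list if the above condition holds.  The distance between
    [i] and [j] does not change after stage [maxn i j] ([stage_stable]), and
    the limit is the required space.

    For saturation, a partial isometry from a finite space [B] to this limit
    is extended to one more point [b] ([one_point_extension]): its list is made
    of the images of the points [x] of the domain with the distances from [x]
    to [b]; the condition on the list is the triangle inequality through [b],
    and a point realizing the list at a stage later than all these images has
    the right distances, the minimum at [h y] being reached at [x = y].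
    Finitely many such steps exhaust [B]. *)

Local Open Scope classical_set_scope.

Set Implicit Arguments.
Unset Strict Implicit.
Unset Printing Implicit Defensive.

Import Order.TTheory GRing.Theory Num.Theory.

Local Open Scope ring_scope.
Local Open Scope ereal_scope.

(** * Gluing one point onto a distance *)

Section Glue.
Variable R : realType.

(** A value allowed for a distance in a generalized rational metric space. *)
Definition rational_value (v : \bar R) : Prop :=
  v = +oo \/ exists q : rat, v = (ratr q)%:E.

Lemma rational_valueD u v :
  rational_value u -> rational_value v -> rational_value (u + v).
Proof.
case=> [->|[q ->]] [->|[r ->]]; try by left.
by right; exists (q + r)%R; rewrite rmorphD EFinD.
Qed.

Lemma ge0_neqNy (v : \bar R) : 0 <= v -> v != -oo.
Proof. by case: v. Qed.

(** The generalized rational metric axioms, for a function on a fixed type. *)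
Record rational_distance (T : Type) (d : T -> T -> \bar R) : Prop := {
  rd_ge0 : forall x y, 0 <= d x y;
  rd_eq0 : forall x y, d x y = 0 <-> x = y;
  rd_sym : forall x y, d x y = d y x;
  rd_tri : forall x y z, d x z <= d x y + d y z;
  rd_rat : forall x y, rational_value (d x y) }.

Variable T : eqType.
Implicit Types (d : T -> T -> \bar R) (s : seq (T * \bar R)) (p m : T).

(** The largest distance function to [m] of a new point which respects the
    upper bounds prescribed by [s]. *)
Definition glue_fun d s m : \bar R :=
  \big[Order.min/+oo]_(x <- s) (x.2 + d x.1 m).

(** The distance [d] with [p] repositioned by gluing along [s]. *)
Definition glue d s p (i j : T) : \bar R :=
  if i == j then 0 else
  if i == p then glue_fun d s j else
  if j == p then glue_fun d s i else d i j.

(** The condition under which the gluing of [p] along [s] is a distance; the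
    reverse inequalities [q <= r + d x y] are only needed for the prescribed
    distances to be realized. *)
Record gluable d s p : Prop := {
  gluable_neq : forall x, x \in s -> x.1 != p;
  gluable_gt0 : forall x, x \in s -> 0 < x.2;
  gluable_rat : forall x, x \in s -> rational_value x.2;
  gluable_le : forall x y, x \in s -> y \in s -> d x.1 y.1 <= x.2 + y.2 }.

Lemma glue_fun_le d s m x : x \in s -> glue_fun d s m <= x.2 + d x.1 m.
Proof.
rewrite /glue_fun; elim: s => // y s IH.
rewrite inE big_cons ge_min => /orP[/eqP ->|/IH ->]; first by rewrite lexx.
by rewrite orbT.
Qed.

Lemma glue_fun_cases d s m :
  glue_fun d s m = +oo \/
  exists2 x, x \in s & glue_fun d s m = x.2 + d x.1 m.
Proof.
rewrite /glue_fun; elim: s => [|y s IH]; first by left; rewrite big_nil.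
rewrite big_cons minEle; case: ifP => _.
  by right; exists y; rewrite ?mem_head.
case: IH => [->|[x xs ->]]; first by left.
by right; exists x; rewrite // inE xs orbT.
Qed.

Lemma le_glue_fun d s m c :
  (forall x, x \in s -> c <= x.2 + d x.1 m) -> c <= glue_fun d s m.
Proof.
move=> H; case: (glue_fun_cases d s m) => [->|[x xs ->]]; first exact: leey.
exact: H.
Qed.

Section GlueDistance.
Variables (d : T -> T -> \bar R) (s : seq (T * \bar R)) (p : T).
Hypothesis (rd : rational_distance d) (gs : gluable d s p).

Let f := glue_fun d s.

Lemma glue_fun_gt0 m : 0 < f m.
Proof.
rewrite /f; case: (glue_fun_cases d s m) => [->|[x xs ->]]; first exact: ltry.
apply: (lt_le_trans (gluable_gt0 gs xs)).
by rewrite leeDl // (rd_ge0 rd).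
Qed.

Lemma glue_fun_rat m : rational_value (f m).
Proof.
rewrite /f; case: (glue_fun_cases d s m) => [->|[x xs ->]]; first by left.
by apply: rational_valueD; [exact: gluable_rat gs _ xs | exact: rd_rat rd _ _].
Qed.

Lemma glue_fun_lipschitz m m' : f m <= f m' + d m' m.
Proof.
rewrite {2}/f; case: (glue_fun_cases d s m') => [->|[x xs ->]].
  by rewrite addye ?leey // ge0_neqNy // (rd_ge0 rd).
apply: (le_trans (glue_fun_le _ _ xs)); rewrite -addeA leeD2l //.
exact: rd_tri rd _ _ _.
Qed.

Lemma glue_fun_sum m m' : d m m' <= f m + f m'.
Proof.
rewrite /f; case: (glue_fun_cases d s m) => [->|[x xs ->]].
  by rewrite addye ?leey // ge0_neqNy // ltW // glue_fun_gt0.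
case: (glue_fun_cases d s m') => [->|[y ys ->]].
  by rewrite addey ?leey // ge0_neqNy // adde_ge0 // ?(rd_ge0 rd) //
    ltW // (gluable_gt0 gs xs).
apply: (le_trans (rd_tri rd m x.1 m')).
rewrite (rd_sym rd m) (addeC x.2) -addeA leeD2l //.
apply: (le_trans (rd_tri rd x.1 y.1 m')).
by rewrite addeA leeD2r // (gluable_le gs xs ys).
Qed.

Lemma rational_distance_glue : rational_distance (glue d s p).
Proof.
have f0 := glue_fun_gt0; have fge m := ltW (f0 m).
have dge := rd_ge0 rd.
have ge0 i j : 0 <= glue d s p i j.
  by rewrite /glue; do ! [case: ifP => // _]; apply: fge.
have sym i j : glue d s p i j = glue d s p j i.
  rewrite /glue (eq_sym j); case: (eqVneq i j) => // ij.
  case: (eqVneq i p) => [ip|_]; case: (eqVneq j p) => [jp|_] //.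
    by rewrite ip jp eqxx in ij.
  exact: rd_sym rd _ _.
split=> // [i j|i j k|i j].
- split=> [|->]; last by rewrite /glue eqxx.
  rewrite /glue; case: eqVneq => // ij.
  case: eqVneq => _; first by move=> e; have := f0 j; rewrite /f e ltxx.
  case: eqVneq => _; first by move=> e; have := f0 i; rewrite /f e ltxx.
  by move/(rd_eq0 rd).
- case: (eqVneq i j) => [->|ij]; first by rewrite leeDr // ge0.
  case: (eqVneq j k) => [->|jk]; first by rewrite leeDl // ge0.
  case: (eqVneq i k) => [->|ik].
    by rewrite {1}/glue eqxx adde_ge0 // ge0.
  rewrite /glue (negbTE ij) (negbTE jk) (negbTE ik).
  case: (eqVneq i p) => [ip|ip].
    have jp : j != p by rewrite -ip eq_sym.
    have kp : k != p by rewrite -ip eq_sym.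
    rewrite (negbTE jp) (negbTE kp); exact: glue_fun_lipschitz.
  case: (eqVneq j p) => [jp|jp].
    have kp : k != p by rewrite -jp eq_sym.
    rewrite (negbTE kp); exact: glue_fun_sum.
  case: eqVneq => _; last exact: rd_tri rd _ _ _.
  rewrite addeC (rd_sym rd i); exact: glue_fun_lipschitz.
- rewrite /glue; case: ifP => _; first by right; exists 0%R; rewrite rmorph0.
  case: ifP => _; first exact: glue_fun_rat.
  by case: ifP => _; [exact: glue_fun_rat | exact: rd_rat rd _ _].
Qed.

End GlueDistance.
End Glue.

(** * The limit distance on the natural numbers *)

(** A countable code for a list of prescribed distances, [None] standing for
    an infinite distance. *)
Definition request := seq (nat * option rat).

(** The second component of the decoded pair is padding: it makes each
    request occur infinitely often. *)
Definition request_at (n : nat) : request :=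
  if @unpickle (request * nat)%type n is Some (s, _) then s else [::].

Lemma request_unbounded (s : request) (N : nat) :
  exists2 n, (N <= n)%N & request_at n = s.
Proof.
pose c (k : nat) := @pickle (request * nat)%type (s, k).
have cinj : injective c by move=> k l /(pcan_inj pickleK)[].
suff [k Nk] : exists k, (N <= c k)%N.
  by exists (c k) => //; rewrite /request_at pickleK.
apply/not_existsP => H.
have cN (k : nat) : (c k < N)%N by rewrite ltnNge; apply/negP/H.
have ginj : injective (fun k : 'I_N.+1 => Ordinal (cN k)).
  by move=> k l [/cinj/val_inj].
by have := leq_card _ ginj; rewrite !card_ord ltnn.
Qed.

Section Limit.
Variable R : realType.

(** The distance coded by an element of a request. *)
Definition value_of (o : option rat) : \bar R :=
  if o is Some q then (ratr q)%:E else +oo.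

Lemma value_ofP (v : \bar R) : rational_value v -> exists o, value_of o = v.
Proof. by case=> [->|[q ->]]; [exists None | exists (Some q)]. Qed.

(** The list of prescribed distances which is treated at stage [n]. *)
Definition prescription (n : nat) : seq (nat * \bar R) :=
  [seq (x.1, value_of x.2) | x <- request_at n].

(** The distance before the point [n] is positioned: only its values on the
    points smaller than [n] are definitive. *)
Fixpoint stage (n : nat) : nat -> nat -> \bar R :=
  if n is k.+1 then
    if `[< gluable (stage k) (prescription k) k >]
    then glue (stage k) (prescription k) k else stage k
  else fun i j => if i == j then 0 else +oo.

Lemma stage_distance n : rational_distance (stage n).
Proof.
elim: n => [|n IH] /=.
  split=> [i j|i j|i j|i j k|i j].
  - by case: ifP.
  - by case: eqVneq => [->|/eqP ij]; split.
  - by rewrite eq_sym.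
  - case: (eqVneq i j) => [->|ij]; first by rewrite add0e.
    by case: (eqVneq j k) => _; rewrite /= ?addye ?leey.
  - by case: ifP => _; [right; exists 0%R; rewrite rmorph0 | left].
by case: asboolP => // gs; exact: rational_distance_glue.
Qed.

Lemma stage_stable n i j : (i < n)%N -> (j < n)%N ->
  stage n i j = stage (maxn i j).+1 i j.
Proof.
elim: n => // n IH; rewrite !ltnS => lin ljn.
case: (eqVneq (maxn i j) n) => [->//|mn].
have [ilt jlt] : (i < n /\ j < n)%N.
  have : (maxn i j < n)%N by rewrite ltn_neqAle mn geq_max lin.
  by rewrite gtn_max => /andP.
rewrite -IH //=; case: asboolP => // _.
rewrite /glue (ltn_eqF ilt) (ltn_eqF jlt).
by case: eqVneq => // ->; apply/esym/(rd_eq0 (stage_distance n)).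
Qed.

(** The value which all late stages give to the pair [i], [j]. *)
Definition limit_dist (i j : nat) : \bar R := stage (maxn i j).+1 i j.

Lemma limit_distE n i j : (i < n)%N -> (j < n)%N ->
  limit_dist i j = stage n i j.
Proof. by move=> ? ?; rewrite stage_stable. Qed.

Lemma limit_dist_distance : rational_distance limit_dist.
Proof.
split=> [i j|i j|i j|i j k|i j].
- exact: rd_ge0 (stage_distance _) _ _.
- exact: rd_eq0 (stage_distance _) _ _.
- by rewrite /limit_dist maxnC; exact: rd_sym (stage_distance _) _ _.
- pose n := (maxn i (maxn j k)).+1.
  have li : (i < n)%N by rewrite ltnS leq_maxl.
  have lj : (j < n)%N by rewrite ltnS !leq_max leqnn orbT.
  have lk : (k < n)%N by rewrite ltnS !leq_max leqnn !orbT.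
  by rewrite !(@limit_distE n) //; exact: rd_tri (stage_distance _) _ _ _.
- exact: rd_rat (stage_distance _) _ _.
Qed.

(** The natural numbers with the limit distance. *)
Definition limit_space : gmetric R :=
  GMetric (rd_ge0 limit_dist_distance) (rd_eq0 limit_dist_distance)
    (rd_sym limit_dist_distance) (rd_tri limit_dist_distance).

(** A request which is gluable for the limit distance is realized by a point of
    the limit, which occurs later than all the points of the request. *)
Lemma limit_realizes (s : request) :
  let t := [seq (x.1, value_of x.2) | x <- s] in
  (forall x, x \in t -> 0 < x.2) ->
  (forall x y, x \in t -> y \in t -> limit_dist x.1 y.1 <= x.2 + y.2) ->
  exists n : nat, forall x, x \in t ->
    limit_dist n x.1 = glue_fun limit_dist t x.1.
Proof.
move=> t t0 tle.
have [n ltn sn] := request_unbounded s (\max_(x <- t) x.1).+1.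
have tn x : x \in t -> (x.1 < n)%N.
  move=> xt; apply: leq_trans ltn; rewrite ltnS.
  exact: (@leq_bigmax_seq _ t xpredT (fun x => x.1)).
have pn : prescription n = t by rewrite /prescription sn.
have gn : gluable (stage n) t n.
  split=> [x /tn/ltn_eqF->//|//|x|x y xt yt].
    case/mapP=> [[i [q|]] _ ->] /=; last by left.
    by right; exists q.
  by rewrite -limit_distE ?tn // tle.
exists n => x xt; have xn := tn _ xt.
rewrite (@limit_distE n.+1) //=; last exact: ltnW.
rewrite pn; case: asboolP => // _.
rewrite /glue eqxx eq_sym (ltn_eqF xn) /glue_fun.
by apply: eq_big_seq => y yt; rewrite -limit_distE ?tn.
Qed.

End Limit.

(** * Saturation *)

Section Saturation.
Variables (R : realType) (B : gmetric R).
Local Notation K := (limit_space R).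

(** A partial isometry with domain [S], as a total function whose values outside
    [S] are irrelevant. *)
Definition isometry_on (S : set B) (h : B -> K) : Prop :=
  forall x y, S x -> S y -> gdist (h x) (h y) = gdist x y.

(** A finite space [B] is given by an enumeration [e], which has to cover [B]
    with its first [N] values. *)
Lemma one_point_extension (N : nat) (e : nat -> B) (S : set B) (h : B -> K)
    (b : B) :
  (forall x, exists2 i, (i < N)%N & e i = x) ->
  rational_gmetric B -> isometry_on S h ->
  exists2 h', isometry_on (S `|` [set b]) h' & forall x, S x -> h' x = h x.
Proof.
move=> eN Brat hS.
have [Sb|nSb] := pselect (S b).
  exists h => // x y Sx Sy; apply: hS.
    by case: Sx => // ->.
  by case: Sy => // ->.
have [o oE] : {o : B -> option rat & forall x, value_of R (o x) = gdist x b}.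
  apply: (@choice _ _ (fun x o => value_of R o = gdist x b)) => x.
  exact: value_ofP (Brat x b).
pose s : request := [seq (h (e i), o (e i)) | i <- iota 0 N & `[< S (e i) >]].
pose t : seq (nat * \bar R) := [seq (x.1, value_of R x.2) | x <- s].
have tP x : x \in t -> exists2 y, S y & x = (h y, gdist y b).
  case/mapP=> z /mapP[i]; rewrite mem_filter => /andP[/asboolP Si _] -> ->.
  by exists (e i); rewrite //= oE.
have tS y : S y -> (h y : nat, gdist y b) \in t.
  move=> Sy; have [i iN ei] := eN y.
  apply/mapP; exists (h y, o y); last by rewrite /= oE.
  apply/mapP; exists i; last by rewrite ei.
  by rewrite mem_filter mem_iota ei iN /= andbT; apply/asboolP.
have [x /tP[y Sy ->]|x y /tP[u Su ->] /tP[v Sv ->]|n nE] := @limit_realizes R s.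
- rewrite lt_neqAle gdist_ge0 andbT eq_sym.
  by apply/eqP => /gdist_eq0 yb; apply: nSb; rewrite -yb.
- rewrite [leLHS](hS _ _ Su Sv) /= (gdist_sym v b); exact: gdist_triangle.
have nd y : S y -> limit_dist R n (h y) = gdist b y.
  move=> Sy; rewrite (nE _ (tS _ Sy)) (gdist_sym b y); apply/eqP; rewrite eq_le.
  apply/andP; split.
    (* the minimum is at most the term of [y] itself, where the added distance
       vanishes *)
    apply: (le_trans (glue_fun_le _ _ (tS _ Sy))) => /=.
    have -> : limit_dist R (h y) (h y) = 0.
      exact: (proj2 (@gdist_eq0 R K (h y) (h y)) erefl).
    by rewrite adde0.
  apply: le_glue_fun => x /tP[z Sz ->] /=.
  have -> : limit_dist R (h z) (h y) = gdist z y := hS _ _ Sz Sy.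
  rewrite addeC (gdist_sym z y); exact: gdist_triangle.
pose h' (x : B) : K := if `[< S x >] then h x else n.
have h'S x : S x -> h' x = h x by rewrite /h'; case: asboolP.
have h'b : h' b = n by rewrite /h'; case: asboolP.
exists h' => // x y [Sx|->] [Sy|->]; rewrite ?h'b ?h'S //.
- exact: hS.
- by rewrite gdist_sym [LHS](nd _ Sx) gdist_sym.
- exact: nd.
- by rewrite (proj2 (gdist_eq0 b b) erefl); apply/gdist_eq0.
Qed.

Lemma finite_extension (N : nat) (e : nat -> B) (S : set B) (h : B -> K) :
  (forall x, exists2 i, (i < N)%N & e i = x) ->
  rational_gmetric B -> isometry_on S h ->
  exists2 h' : B -> K, Defs.isometry h' & forall x, S x -> h' x = h x.
Proof.
move=> eN Brat hS.
suff [h' iso h'h] : exists2 h', isometry_on (S `|` e @` `I_N) h' &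
    forall x, S x -> h' x = h x.
  exists h' => // x y; apply: iso.
    by right; have [i iN <-] := eN x; exists i.
  by right; have [i iN <-] := eN y; exists i.
elim: (N) => [|k [h1 iso1 h1h]].
  by exists h => // x y [Sx|[]//] [Sy|[]//]; exact: hS.
have [h2 iso2 h2h] := one_point_extension (e k) eN Brat iso1.
exists h2 => [x y Sx Sy|x Sx]; last by rewrite h2h ?h1h //; left.
have sub z : (S `|` e @` `I_k.+1) z ->
    ((S `|` e @` `I_k) `|` [set e k]) z.
  case=> [Sz|[i /=]]; first by left; left.
  rewrite ltnS leq_eqVlt => /orP[/eqP -> <-|ik <-]; first by right.
  by left; right; exists i.
by apply: iso2; exact: sub.
Qed.

End Saturation.

Lemma isometry_inj (R : realType) (X Y : gmetric R) (f : X -> Y) :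
  Defs.isometry f -> injective f.
Proof.
by move=> iso x y fxy; apply/gdist_eq0; rewrite -iso; apply/gdist_eq0.
Qed.

Lemma finite_enumeration (T : Type) (x0 : T) : finite_set [set: T] ->
  exists N (e : nat -> T), forall x, exists2 i, (i < N)%N & e i = x.
Proof.
case=> N /card_set_bijP[u [uN uinj _]].
have [e eP] : {e : nat -> T & forall i, forall x, u x = i -> e i = x}.
  apply: (@choice _ _ (fun i y => forall x, u x = i -> y = x)) => i.
  have [[y uy]|ny] := pselect (exists y, u y = i).
    by exists y => x ux; apply: uinj; rewrite ?in_setT // uy.
  by exists x0 => x ux; case: ny; exists x.
by exists N, e => x; exists (u x); [exact: uN | exact: eP].
Qed.

Lemma limit_space_saturated (R : realType) : aleph0_saturated (limit_space R).
Proof.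
split; first by move=> i j; exact: rd_rat (limit_dist_distance R) _ _.
move=> A B f g _ _ Brat Bfin isof isog.
have [[b0 _]|B0] := pselect (exists b : B, True); last first.
  exists (fun=> 0%N); split=> [x|]; first by case: B0; exists x.
  by apply/funext => a; case: B0; exists (f a).
have [N [e eN]] := finite_enumeration b0 Bfin.
(* the partial isometry [g \o f^-1] on the range of [f], with the arbitrary
   value [0] elsewhere *)
have [h0 h0f] : exists h0 : B -> limit_space R, forall a, h0 (f a) = g a.
  have [h0 h0P] : {h0 : B -> limit_space R &
      forall b, forall a, f a = b -> h0 b = g a}.
    apply: (@choice _ _ (fun b k => forall a, f a = b -> k = g a)) => b.
    have [[a fa]|na] := pselect (exists a, f a = b).
      by exists (g a) => a' fa'; congr g; apply: (isometry_inj isof); rewrite fa.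
    by exists 0%N => a fa; case: na; exists a.
  by exists h0 => a; exact: h0P.
have h0iso : isometry_on (range f) h0.
  by move=> _ _ [a _ <-] [a' _ <-]; rewrite !h0f isog isof.
have [h isoh hh0] := finite_extension eN Brat h0iso.
exists h; split=> //; apply/funext => a /=.
by rewrite hh0 //; exists a.
Qed.

Theorem theorem6p1 (R : realType) :
  exists K : gmetric R, aleph0_saturated K /\ countable [set: K].
Proof.
exists (limit_space R); split; first exact: limit_space_saturated.
exact: (@countableP nat).
Qed.
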